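(* Let $R$ be a unital ring with $\frac12$ and let $A=M_n(R)$ with $n\ge 2$. If a surjective additive map $T:A\to A$ satisfies, for all $x,y\in A$, $$xy=yx=0\implies T(x)\circ T(y)=0$$ (in particular, if $T$ preserves zero Jordan products, i.e. $T(x)\circ T(y)=0$ whenever $x\circ y=0$), then $T$ is a weighted Jordan homomorphism.
   Context: Rings are associative (not necessarily commutative). $M_n(R)$ is the ring of $n\times n$ matrices over $R$. In any ring, $x\circ y=xy+yx$ denotes the Jordan product. A ring with $\frac12$ is a unital ring in which $1+1$ is invertible. An additive map $\Phi:A\to B$ between unital rings is a Jordan homomorphism if $\Phi(x\circ y)=\Phi(x)\circ\Phi(y)$ for all $x,y\in A$. An additive map $T:A\to B$ is a weighted Jordan homomorphism if $c=T(1)$ is an invertible element lying in the center of $B$ and $x\mapsto c^{-1}T(x)$ is a Jordan homomorphism, that is, $cT(x\circ y)=T(x)\circ T(y)$ for all $x,y\in A$. *)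

(* Defs.v *)
From HB Require Import structures.
From mathcomp Require Import all_boot all_order all_algebra.

Set Implicit Arguments.
Unset Strict Implicit.
Unset Printing Implicit Defensive.

Import GRing.Theory.
Local Open Scope ring_scope.

(* Rings are [pzRingType]: associative, unital, possibly noncommutative, and
   possibly zero.  In particular ['M[R]_n] is a ring for every [n], and no
   decidability of units is assumed. *)

Definition inverse_of (A : pzRingType) (a b : A) : Prop :=
  a * b = 1 /\ b * a = 1.

Definition invertible (A : pzRingType) (a : A) : Prop :=
  exists b : A, inverse_of a b.

Definition has_half (A : pzRingType) : Prop := invertible (1 + 1 : A).

Definition jordan_mul (A : pzRingType) (x y : A) : A := x * y + y * x.

Definition central (A : pzRingType) (c : A) : Prop :=
  forall x : A, GRing.comm c x.

Definition surjective_map (A B : Type) (f : A -> B) : Prop :=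
  forall y : B, exists x : A, f x = y.

Definition jordan_hom (A B : pzRingType) (f : A -> B) : Prop :=
  zmod_morphism f /\
  forall x y : A, f (jordan_mul x y) = jordan_mul (f x) (f y).

(* [c] below is the (unique) inverse of [T 1]. *)
Definition weighted_jordan_hom (A B : pzRingType) (T : A -> B) : Prop :=
  [/\ zmod_morphism T,
      central (T 1)
    & exists c : B, inverse_of (T 1) c /\ jordan_hom (fun x => c * T x)].

Definition kills_two_sided_zero_products (A B : pzRingType) (T : A -> B) :
    Prop :=
  forall x y : A, x * y = 0 -> y * x = 0 -> jordan_mul (T x) (T y) = 0.

Definition preserves_zero_jordan_products (A B : pzRingType) (T : A -> B) :
    Prop :=
  forall x y : A, jordan_mul x y = 0 -> jordan_mul (T x) (T y) = 0.

(* Main.v *)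
Require Import Defs.
From HB Require Import structures.
From mathcomp Require Import all_boot all_order all_algebra.

Set Implicit Arguments.
Unset Strict Implicit.
Unset Printing Implicit Defensive.

Import GRing.Theory.
Local Open Scope ring_scope.

(** Write [x o y] for the Jordan product, [c = T 1] and
[phi x y = T x o T y], a symmetric biadditive map that vanishes as soon as
[x y = y x = 0].  The proof has two halves.

The domain.  For an idempotent [e] and any [x], splitting [x] into its Peirce
pieces gives [2 phi e x = phi (e o x) 1]: the diagonal pieces are annihilated
by [1 - e] or by [e], and for an off-diagonal piece [u] the idempotent [e + u]
and its complement provide the relation ([factors_idempotent]).  By additivity
[e] may be any element of the additive span of the idempotents.  In a matrix
ring of size at least two this span contains [r e_ij] and [r e_ii - r e_jj] for
[i <> j]; what is missing is only one diagonal entry, and since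
[phi (r e_jj) (s e_ii) = 0], the relation passes from [r e_ii - r e_jj] to
[r e_ii].  Hence [2 phi x y = phi (x o y) 1] for all matrices
([matrix_factors_through_jordan]), that is [2 (T x o T y) = T (x o y) o c].

The codomain.  It remains to see that [c] is central and invertible.  For an
idempotent [e] put [p = T e]; then [p o (c - p) = 0], from which [p] commutes
with [c^2].  Every matrix is a sum of Jordan products of elements spanned by
idempotents, so the relation shows that [c^2] commutes with [T x o c] for all
[x].  Taking [x0] with [T x0 = 1], the relation reads
[4 T y = T (x0 o y) o c], so that [b |-> b o c] is onto, and [z = c^2] is
central.  Then [c (u c + c u) c = z (u c + c u)], so [c b c = z b] for all [b];
hence [b |-> b o c] squares to [4 z], which makes [z] invertible, and
[z (b c - c b) = 0], which makes [c] central
([central_of_central_square]). *)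

(** * Jordan products and additive spans *)

Lemma jordan_mulC (A : pzRingType) (x y : A) :
  jordan_mul x y = jordan_mul y x.
Proof. exact: addrC. Qed.

Lemma jordan_mulBl (A : pzRingType) (y : A) :
  zmod_morphism (fun x => jordan_mul x y).
Proof. by move=> x x'; rewrite /jordan_mul mulrBl mulrBr opprD addrACA. Qed.

Lemma mulr4n_surj (A : pzRingType) (hA : has_half A) (a : A) :
  exists b : A, b *+ 4 = a.
Proof.
have [h [h1 _]] := hA; exists (h * h * a).
have h2 : h *+ 2 = 1 by rewrite -h1 mulrDl mul1r mulr2n.
have -> : (h * h * a) *+ 4 = (h *+ 2) * (h *+ 2) * a.
  by rewrite mulrnAl mulrnAr !mulrnAl -mulrnA.
by rewrite h2 !mul1r.
Qed.

Definition idempotent (A : pzRingType) (e : A) : Prop := e * e = e.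

Inductive additive_span (V : zmodType) (S : V -> Prop) : V -> Prop :=
| span_gen x of S x : additive_span S x
| span0 : additive_span S 0
| spanB x y of additive_span S x & additive_span S y :
    additive_span S (x - y).

Lemma spanD (V : zmodType) (S : V -> Prop) (x y : V) :
  additive_span S x -> additive_span S y -> additive_span S (x + y).
Proof.
move=> Sx Sy; rewrite -[y]opprK -[- y]sub0r; apply: spanB => //.
by apply: spanB => //; apply: span0.
Qed.

(** * Biadditive maps vanishing on two-sided zero products *)

Definition sym_biadditive (A X : zmodType) (phi : A -> A -> X) : Prop :=
  (forall x y, phi x y = phi y x) /\ (forall y, zmod_morphism (phi^~ y)).

Definition vanishes_on_zero_products (A : pzRingType) (X : zmodType)
    (phi : A -> A -> X) : Prop :=
  forall x y, x * y = 0 -> y * x = 0 -> phi x y = 0.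

Lemma biadd_Bl (A X : zmodType) (phi : A -> A -> X) :
  sym_biadditive phi -> forall x y z, phi (x - y) z = phi x z - phi y z.
Proof. by case=> _ h x y z; apply: h. Qed.

Lemma biadd_Br (A X : zmodType) (phi : A -> A -> X) :
  sym_biadditive phi -> forall x y z, phi z (x - y) = phi z x - phi z y.
Proof. by case=> s h x y z; rewrite !(s z); apply: h. Qed.

Lemma biadd_0l (A X : zmodType) (phi : A -> A -> X) :
  sym_biadditive phi -> forall z, phi 0 z = 0.
Proof. by move=> h z; rewrite -(subrr 0) (biadd_Bl h) subrr. Qed.

Lemma biadd_Dl (A X : zmodType) (phi : A -> A -> X) :
  sym_biadditive phi -> forall x y z, phi (x + y) z = phi x z + phi y z.
Proof.
move=> h x y z; rewrite -{1}[y]opprK -[- y]sub0r !(biadd_Bl h).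
by rewrite (biadd_0l h) sub0r opprK.
Qed.

(** If [phi x y = g (x o y)] with [g] additive, then [phi w 1 = g (2 w)]; this
is where the factor 2 comes from. *)
Definition factors_through_jordan (A : pzRingType) (X : zmodType)
    (phi : A -> A -> X) (x y : A) : Prop :=
  phi x y *+ 2 = phi (jordan_mul x y) 1.

Lemma factorsC (A : pzRingType) (X : zmodType) (phi : A -> A -> X) x y :
  sym_biadditive phi ->
  factors_through_jordan phi x y -> factors_through_jordan phi y x.
Proof.
by move=> h; rewrite /factors_through_jordan (h.1 y) (jordan_mulC y).
Qed.

(** The elements satisfying the relation against a fixed [y] form an additive
subgroup, which is how it spreads from idempotents to their span. *)
Lemma factors_spanl (A : pzRingType) (X : zmodType) (phi : A -> A -> X)
    (S : A -> Prop) (y : A) :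
  sym_biadditive phi ->
  (forall x, S x -> factors_through_jordan phi x y) ->
  forall x, additive_span S x -> factors_through_jordan phi x y.
Proof.
move=> h hS x; elim=> [{}x /hS//||x1 x2 _ h1 _ h2].
  by rewrite /factors_through_jordan /jordan_mul mul0r mulr0 addr0
             !(biadd_0l h) mul0rn.
rewrite /factors_through_jordan jordan_mulBl !(biadd_Bl h).
by rewrite mulrnBl h1 h2.
Qed.

Lemma factorsDr (A : pzRingType) (X : zmodType) (phi : A -> A -> X) x y z :
  sym_biadditive phi -> factors_through_jordan phi x y ->
  factors_through_jordan phi x z -> factors_through_jordan phi x (y + z).
Proof.
move=> h /(factorsC h) hy /(factorsC h) hz; apply: factorsC => //.
apply: (@factors_spanl _ _ _ (factors_through_jordan phi ^~ x)) => //.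
by apply: spanD; apply: span_gen.
Qed.

Lemma vanishes_on_idempotent_complement (A : pzRingType) (X : zmodType)
    (phi : A -> A -> X) (e : A) :
  vanishes_on_zero_products phi -> idempotent e -> phi e (1 - e) = 0.
Proof.
by move=> h he; apply: h; rewrite ?mulrBr ?mulrBl ?mulr1 ?mul1r he subrr.
Qed.

(** The assumptions on [u] make [e + u] an idempotent too; expanding
[phi (e + u) (1 - e - u) = 0] leaves [phi u 1 = 2 phi e u]. *)
Lemma factors_off_diagonal (A : pzRingType) (X : zmodType)
    (phi : A -> A -> X) (e u : A) :
  sym_biadditive phi -> vanishes_on_zero_products phi -> idempotent e ->
  jordan_mul e u = u -> u * u = 0 -> factors_through_jordan phi e u.
Proof.
move=> hb hv he heu huu; rewrite /factors_through_jordan heu.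
have heu2 : idempotent (e + u).
  by rewrite /idempotent mulrDl !mulrDr he huu addr0 -addrA -/(jordan_mul e u)
             heu.
have phi_uu : phi u u = 0 by apply: hv.
have := vanishes_on_idempotent_complement hv heu2.
rewrite opprD addrA (biadd_Br hb) !(biadd_Dl hb) phi_uu addr0.
rewrite vanishes_on_idempotent_complement //.
rewrite add0r (biadd_Br hb) (hb.1 u e) => /eqP.
by rewrite -addrA -opprD subr_eq0 => /eqP ->; rewrite mulr2n.
Qed.

(** The relation is additive in [x], so it is enough to have it on the four
Peirce pieces of [x] relative to [e]. *)
Lemma factors_idempotent (A : pzRingType) (X : zmodType)
    (phi : A -> A -> X) (e x : A) :
  sym_biadditive phi -> vanishes_on_zero_products phi -> idempotent e ->
  factors_through_jordan phi e x.
Proof.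
move=> hb hv he; set f := 1 - e.
have ef : e * f = 0 by rewrite mulrBr mulr1 he subrr.
have fe : f * e = 0 by rewrite mulrBl mul1r he subrr.
have -> : x = (e * x * e + e * x * f) + (f * x * e + f * x * f).
  by rewrite -!mulrDr -!mulrDl addrC subrK mulr1 mul1r.
apply: factorsDr => //; apply: factorsDr => //.
- have : phi (e * x * e) f = 0.
    by apply: hv; rewrite ?mulrA ?fe ?mul0r // -mulrA ef mulr0.
  rewrite (biadd_Br hb) => /eqP; rewrite subr_eq0 => /eqP h1.
  rewrite /factors_through_jordan /jordan_mul !mulrA he -!mulrA he.
  by rewrite (biadd_Dl hb) mulrA h1 (hb.1 e) mulr2n.
- apply: factors_off_diagonal => //.
    by rewrite /jordan_mul !mulrA he -!mulrA fe !mulr0 addr0.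
  by rewrite !mulrA -(mulrA _ f e) fe mulr0 !mul0r.
- apply: factors_off_diagonal => //.
    by rewrite /jordan_mul !mulrA ef !mul0r add0r -!mulrA he.
  by rewrite !mulrA -(mulrA _ e f) ef mulr0 !mul0r.
- rewrite /factors_through_jordan /jordan_mul !mulrA ef !mul0r add0r.
  rewrite -!mulrA fe !mulr0 (biadd_0l hb) (hv e) ?mul0rn //;
    first by rewrite !mulrA ef !mul0r.
  by rewrite -!mulrA fe !mulr0.
Qed.

Lemma factors_idempotent_span (A : pzRingType) (X : zmodType)
    (phi : A -> A -> X) (x y : A) :
  sym_biadditive phi -> vanishes_on_zero_products phi ->
  additive_span (@idempotent A) x -> factors_through_jordan phi x y.
Proof.
move=> hb hv; apply: factors_spanl => // e he.
exact: factors_idempotent.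
Qed.

(** * Matrices and spans of idempotents *)

Lemma mul_scale_delta (R : pzRingType) (n : nat) (i j k l : 'I_n) (r s : R) :
  (r *: delta_mx i j : 'M[R]_n) * (s *: delta_mx k l) =
  if j == k then (r * s) *: delta_mx i l else 0.
Proof.
apply/matrixP => a b; rewrite -mulmxE -scalemxAl !mxE.
rewrite (bigD1 j) //= big1 => [|m /negPf mj]; last first.
  by rewrite !mxE mj andbF mul0r.
rewrite !mxE eqxx andbT addr0; case: (j == k); last first.
  by rewrite !mulr0 mxE.
rewrite !mxE /=; case: (a == i); case: (b == l) => /=;
  by rewrite ?(mul0r, mulr0, mul1r, mulr1).
Qed.

Lemma mul_scale_delta_eq (R : pzRingType) (n : nat) (i j k : 'I_n) (r s : R) :
  (r *: delta_mx i j : 'M[R]_n) * (s *: delta_mx j k) =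
  (r * s) *: delta_mx i k.
Proof. by rewrite mul_scale_delta eqxx. Qed.

Lemma mul_scale_delta_neq (R : pzRingType) (n : nat) (i j k l : 'I_n)
    (r s : R) :
  j != k -> (r *: delta_mx i j : 'M[R]_n) * (s *: delta_mx k l) = 0.
Proof. by move=> /negPf jk; rewrite mul_scale_delta jk. Qed.

(** [e_ii + r e_ij] and [e_ii] are idempotents. *)
Lemma span_off_diagonal (R : pzRingType) (n : nat) (i j : 'I_n) (r : R) :
  i != j -> additive_span (@idempotent 'M[R]_n) (r *: delta_mx i j).
Proof.
move=> ij; have ji : j != i by rewrite eq_sym.
have -> : r *: delta_mx i j =
    (1 *: delta_mx i i + r *: delta_mx i j) - 1 *: delta_mx i i :> 'M[R]_n.
  by rewrite addrC addKr.
apply: spanB; apply: span_gen; rewrite /idempotent;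
  last by rewrite mul_scale_delta_eq mulr1.
rewrite mulrDl !mulrDr !mul_scale_delta_eq !mul_scale_delta_neq //.
by rewrite !mul1r !addr0.
Qed.

(** With [t = 1 - r], the matrix with rows [(r, r)] and [(t, t)] in positions
[i, j] is an idempotent: it is a column times a row whose product in the other
order is [r + t = 1].  Its diagonal is [(r, 1 - r)], and the rest can be removed
using off-diagonal entries and [e_jj]. *)
Lemma span_diagonal_diff (R : pzRingType) (n : nat) (i j : 'I_n) (r : R) :
  i != j ->
  additive_span (@idempotent 'M[R]_n) (r *: delta_mx i i - r *: delta_mx j j).
Proof.
move=> ij; have ji : j != i by rewrite eq_sym.
pose t := 1 - r.
pose a : 'M[R]_n := r *: delta_mx i i + t *: delta_mx j i.
pose b : 'M[R]_n := 1 *: delta_mx i i + 1 *: delta_mx i j.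
have ba : b * a = 1 *: delta_mx i i.
  rewrite /a /b mulrDl !mulrDr !mul_scale_delta_eq !mul_scale_delta_neq //.
  by rewrite !mul1r addr0 add0r -scalerDl /t addrC subrK.
have idem_ab : idempotent (a * b).
  have ae : a * (1 *: delta_mx i i) = a.
    by rewrite /a mulrDl !mul_scale_delta_eq !mulr1.
  by rewrite /idempotent mulrA -(mulrA a b a) ba ae.
have abE : a * b = (r *: delta_mx i i + t *: delta_mx j j) +
                   (r *: delta_mx i j + t *: delta_mx j i).
  rewrite /a /b mulrDl !mulrDr !mul_scale_delta_eq !mulr1.
  by rewrite [X in _ + X]addrC addrACA.
have -> : r *: delta_mx i i - r *: delta_mx j j =
    a * b - (r *: delta_mx i j + t *: delta_mx j i) - 1 *: delta_mx j j.
  by rewrite abE addrK -addrA -scalerBl /t addrAC subrr sub0r scaleNr.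
apply: spanB; first apply: spanB; first exact: span_gen.
  by apply: spanD; apply: span_off_diagonal.
by apply: span_gen; rewrite /idempotent mul_scale_delta_eq mulr1.
Qed.

Lemma exists_other_index (n : nat) (i : 'I_n) :
  (2 <= n)%N -> exists j : 'I_n, i != j.
Proof.
case: n i => [|[|n]] // i _.
by case: (eqVneq i ord0) => [->|ne]; [exists ord_max | exists ord0].
Qed.

Lemma matrix_additive_ind (R : pzRingType) (n : nat) (P : 'M[R]_n -> Prop) :
  P 0 -> (forall x y, P x -> P y -> P (x + y)) ->
  (forall i j r, P (r *: delta_mx i j)) -> forall x, P x.
Proof.
move=> P0 PD Pd x; rewrite [x]matrix_sum_delta.
by apply: big_ind => // i _; apply: big_ind => // j _; apply: Pd.
Qed.

(** A single diagonal entry [r e_kk] need not lie in the span of the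
idempotents, so two such entries have to be treated separately. If they sit in
different positions their products vanish; if they sit in the same position [k],
one of them is moved to another position at the cost of
[r e_kk - r e_jj], which does lie in the span. *)
Lemma matrix_factors_through_jordan (R : pzRingType) (n : nat) (X : zmodType)
    (phi : 'M[R]_n -> 'M[R]_n -> X) (x y : 'M[R]_n) :
  (2 <= n)%N -> sym_biadditive phi -> vanishes_on_zero_products phi ->
  factors_through_jordan phi x y.
Proof.
move=> hn hb hv.
have f0 a : factors_through_jordan phi a 0.
  by rewrite /factors_through_jordan /jordan_mul mul0r mulr0 addr0 hb.1
             !(biadd_0l hb) mul0rn.
have fE a b : additive_span (@idempotent 'M[R]_n) a ->
    factors_through_jordan phi b a.
  by move=> ha; apply: factorsC => //; apply: factors_idempotent_span.
have span_or_diag i j r : additive_span (@idempotent 'M[R]_n)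
    (r *: delta_mx i j) \/ i = j.
  by case: (eqVneq i j) => [|ij]; [right | left; apply: span_off_diagonal].
elim/matrix_additive_ind: y => [//|y1 y2 h1 h2|k l s]; first exact: factorsDr.
have [/fE //|<-] := span_or_diag k l s; apply: factorsC => //.
elim/matrix_additive_ind: x => [//|x1 x2 h1 h2|i j r]; first exact: factorsDr.
have [/fE //|<-] := span_or_diag i j r; apply: factorsC => //.
have cross i' r' : i' != k ->
    factors_through_jordan phi (r' *: delta_mx i' i') (s *: delta_mx k k).
  move=> ik; have ki : k != i' by rewrite eq_sym.
  rewrite /factors_through_jordan /jordan_mul !mul_scale_delta_neq // addr0.
  by rewrite (biadd_0l hb) hv ?mul0rn // mul_scale_delta_neq.
have [->|] := eqVneq i k; last exact: cross.
have [j' kj'] := exists_other_index k hn.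
have -> : r *: delta_mx k k = (r *: delta_mx k k - r *: delta_mx j' j') +
                              r *: delta_mx j' j' :> 'M[R]_n.
  by rewrite subrK.
apply: factorsC => //; apply: factorsDr => //.
  by apply/fE/span_diagonal_diff.
by apply: factorsC => //; apply: cross; rewrite eq_sym.
Qed.

(** The span of the idempotents can be strictly smaller than the matrix ring,
but one Jordan product is enough to reach every elementary matrix:
[r e_ij = e_ii o r e_ij], and the remaining diagonal ones come from
[e_ii o (s e_ii - s e_kk) = 2 s e_ii]. *)
Lemma matrix_span_jordan (R : pzRingType) (n : nat) (x : 'M[R]_n) :
  has_half R -> (2 <= n)%N ->
  additive_span (fun w => exists a b,
    [/\ additive_span (@idempotent 'M[R]_n) a,
        additive_span (@idempotent 'M[R]_n) b & w = jordan_mul a b]) x.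
Proof.
move=> [h [h1 _]] hn; have hh : h + h = 1 by rewrite -[h]mul1r -mulrDl.
elim/matrix_additive_ind: x => [|x y|i j r]; first exact: span0.
  exact: spanD.
apply: span_gen; have idi : additive_span (@idempotent 'M[R]_n)
    (1 *: delta_mx i i).
  by apply: span_gen; rewrite /idempotent mul_scale_delta_eq mulr1.
have [<-|ij] := eqVneq i j.
  have [k ik] := exists_other_index i hn.
  exists (1 *: delta_mx i i).
  exists ((r * h) *: delta_mx i i - (r * h) *: delta_mx k k).
  split=> //; first exact: span_diagonal_diff.
  have ki : k != i by rewrite eq_sym.
  rewrite /jordan_mul mulrBl mulrBr !mul_scale_delta_eq !mul_scale_delta_neq //.
  by rewrite !subr0 mul1r mulr1 -scalerDl -mulrDr hh mulr1.
exists (1 *: delta_mx i i), (r *: delta_mx i j).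
split=> //; first exact: span_off_diagonal.
have ji : j != i by rewrite eq_sym.
by rewrite /jordan_mul mul_scale_delta_eq mul_scale_delta_neq // mul1r addr0.
Qed.

(** * Centrality and invertibility of the weight *)

(** The identity [c b c = c^2 b], read off on [b = u o c], carries everything.
It turns the square of [b |-> b o c] into multiplication by [4 c^2], so that
surjectivity makes [c^2] invertible; and multiplying it by [c] on the left
shows that [c^2] kills all commutators with [c]. *)
Lemma central_of_central_square (B : pzRingType) (c : B) :
  central (c * c) -> (forall b, exists u, jordan_mul u c = b) ->
  central c /\ invertible c.
Proof.
move=> hz hL.
have czc b : c * b * c = c * c * b.
  have [u <-] := hL b; rewrite /jordan_mul !mulrDr mulrDl !mulrA addrC.
  by congr (_ + _); rewrite -(mulrA (c * u)) -(hz (c * u)) mulrA.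
have LL b : jordan_mul (jordan_mul b c) c = c * c * b *+ 4.
  rewrite /jordan_mul mulrDl mulrDr !mulrA czc -(mulrA b) -hz.
  by rewrite !addrA -mulr2n -!mulrSr.
have [u Lu] := hL 1; have [v Lv] := hL u.
have zw : c * c * (v *+ 4) = 1 by rewrite mulrnAr -LL Lv.
have cC : central c.
  move=> x; have zx : c * c * (c * x) = c * c * (x * c).
    by rewrite -[RHS]mulrA [c * (x * c)]mulrA czc !mulrA.
  rewrite /GRing.comm -[c * x]mul1r -[x * c]mul1r -zw (hz (v *+ 4)).
  by rewrite -!(mulrA (v *+ 4)) zx.
split=> //; exists (c * (v *+ 4)); split; first by rewrite mulrA.
by rewrite -(cC (c * _)) mulrA.
Qed.


(** Put [p = T e] and [c = T 1]. Applying the hypothesis to [e] and [1 - e]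
gives [p o c = 2 p^2].  Commuting this with [p] shows that [p^2] commutes
with [c]; hence so does [p o c], and [[p o c, c] = [p, c^2]]. *)
Lemma square_weight_comm_idempotent (A B : pzRingType) (T : {additive A -> B})
    (e : A) :
  kills_two_sided_zero_products T -> idempotent e ->
  GRing.comm (T 1 * T 1) (T e).
Proof.
move=> hT he; set c := T 1; set p := T e.
have := vanishes_on_idempotent_complement
  (phi := fun x y => jordan_mul (T x) (T y)) hT he.
rewrite raddfB /= -/c -/p /jordan_mul mulrBr mulrBl => /eqP.
rewrite addrACA -opprD subr_eq0 => /eqP pc.
have p2c : p * p * c = c * (p * p).
  have : p * (p * c + c * p) = (p * c + c * p) * p.
    by rewrite pc mulrDr mulrDl !mulrA.
  by rewrite mulrDr mulrDl !mulrA addrC => /addrI <-.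
have : (p * c + c * p) * c = c * (p * c + c * p).
  by rewrite pc mulrDr mulrDl p2c.
by rewrite mulrDr mulrDl !mulrA addrC => /addrI; rewrite -mulrA.
Qed.

(** Only two features of the domain matter: the factorization of [T x o T y]
through [x o y], and the fact that Jordan products of spans of idempotents
additively exhaust it.  The second one upgrades the commutation of [c^2] with
the images of idempotents to centrality. *)
Lemma weighted_jordan_hom_of_factors (A B : pzRingType)
    (T : {additive A -> B}) :
  has_half B -> surjective_map T -> kills_two_sided_zero_products T ->
  (forall x y,
    factors_through_jordan (fun x y => jordan_mul (T x) (T y)) x y) ->
  (forall x, additive_span (fun w => exists a b,
    [/\ additive_span (@idempotent A) a,
        additive_span (@idempotent A) b & w = jordan_mul a b]) x) ->
  weighted_jordan_hom T.
Proof.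
move=> hB hsurj hT hf hspan; set c := T 1.
have sqC x : additive_span (@idempotent A) x -> GRing.comm (c * c) (T x).
  elim=> [e /(square_weight_comm_idempotent hT)//||x1 x2 _ h1 _ h2].
    by rewrite raddf0; apply: commr0.
  by rewrite raddfB; apply: commrB.
have [x0 Tx0] := hsurj 1.
have hL b : exists u, jordan_mul u c = b.
  have [b' <-] := mulr4n_surj hB b; have [y <-] := hsurj b'.
  (* The relation at [x0], [y] reads [4 T y = T (x0 o y) o c]. *)
  exists (T (jordan_mul x0 y)); rewrite -hf Tx0 /jordan_mul mul1r mulr1.
  by rewrite -mulr2n -mulrnA.
have c2C : central (c * c).
  move=> b; have [u <-] := hL b; have [x <-] := hsurj u.
  elim: (hspan x) => [_ [a [a' [sa sa' ->]]]||x1 x2 _ h1 _ h2].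
  - rewrite -hf; apply: commrMn.
    by apply: commrD; apply: commrM; apply: sqC.
  - by rewrite raddf0 /jordan_mul mul0r mulr0 addr0; apply: commr0.
  - by rewrite raddfB jordan_mulBl; apply: commrB.
have [cC [d [cd dc]]] := central_of_central_square c2C hL.
split=> //; first exact: raddfB.
exists d; split; first by [].
have dC b : GRing.comm d b.
  rewrite /GRing.comm -[b * d]mul1r -dc -!mulrA; congr (d * _).
  by rewrite [c * _]mulrA (cC b) -mulrA cd mulr1.
split=> [x y|x y]; first by rewrite raddfB mulrBr.
have [h [_ h2]] := hB.
have half_inj (a b : B) : a *+ 2 = b *+ 2 -> a = b.
  rewrite -[a *+ 2]mulr_natl -[b *+ 2]mulr_natl => /(congr1 ( *%R h)).
  rewrite !mulrA.
  by rewrite (_ : h * 2%:R = 1) ?mul1r // -h2.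
have JE : jordan_mul (T x) (T y) = c * T (jordan_mul x y).
  by apply: half_inj; rewrite (hf x y) /jordan_mul -/c -cC mulr2n.
have -> : jordan_mul (d * T x) (d * T y) = d * (d * jordan_mul (T x) (T y)).
  rewrite /jordan_mul !mulrDr; congr (_ + _).
    by rewrite -!mulrA (mulrA (T x)) -(dC (T x)) !mulrA.
  by rewrite -!mulrA (mulrA (T y)) -(dC (T y)) !mulrA.
by rewrite JE (mulrA d c) dc mul1r.
Qed.

Lemma has_half_matrix (R : pzRingType) (n : nat) :
  has_half R -> has_half 'M[R]_n.
Proof.
move=> [h [h1 h2]]; exists h%:M; rewrite /inverse_of -!mulmxE.
have -> : 1 + 1 = (1 + 1)%:M :> 'M[R]_n by rewrite raddfD.
by rewrite -!scalar_mxM h1 h2.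
Qed.

Theorem corollary2p4 (R : pzRingType) (n : nat) (hR : has_half R)
    (hn : (2 <= n)%N) (T : 'M[R]_n -> 'M[R]_n)
    (T_additive : zmod_morphism T) (T_surjective : surjective_map T) :
  (kills_two_sided_zero_products T -> weighted_jordan_hom T) /\
  (preserves_zero_jordan_products T -> weighted_jordan_hom T).
Proof.
have main : kills_two_sided_zero_products T -> weighted_jordan_hom T.
  pose T_mixin := GRing.isZmodMorphism.Build _ _ T T_additive.
  pose T' : {additive 'M[R]_n -> 'M[R]_n} := HB.pack T T_mixin.
  move=> hT; apply: (@weighted_jordan_hom_of_factors _ _ T') => //.
  - exact: has_half_matrix.
  - move=> x y; apply: matrix_factors_through_jordan => //.
    split=> [a b|b a a']; first exact: jordan_mulC.
    by rewrite raddfB jordan_mulBl.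
  - by move=> x; apply: matrix_span_jordan.
split=> // hT; apply: main => x y xy yx; apply: hT.
by rewrite /jordan_mul xy yx addr0.
Qed.
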